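(* Let $A_\delta:=\{\boldsymbol{x}\in\mathbb{R}^n\mid\mathrm{dist}(\boldsymbol{x},A)\le\delta\}$ for any $\delta>0$. Then, for $\alpha\in(0,1)$, the risk-constrained safe set $RS_{\alpha,\delta}(A)$ is a subset of the probabilistic safe set $S_{\alpha^T}(A_\delta)$, i.e. $$RS_{\alpha,\delta}(A)\subseteq S_{\alpha^T}(A_\delta),$$ where $\alpha^T$ is the $T$-th power of $\alpha$ and $T$ is the horizon.
   Context: Setting. Consider the discrete-time stochastic system $x_{t+1}=f(x_t,u_t,w_t)$ with state $x_t\in\mathbb{R}^n$, control $u_t\in\mathbb{U}$, where $\mathbb{U}\subseteq\mathbb{R}^m$ is convex, and stochastic disturbance $w_t\in\mathbb{W}\subseteq\mathbb{R}^l$ defined on a filtered probability space $(\Omega,\mathcal{F},\{\mathcal{F}_t\}_{t\ge0},\mathbb{P})$; $w_t$ is $\mathcal{F}_t$-measurable and so is $x_{t+1}$. The $\sigma$-algebra $\mathcal{F}_{t-1}$ represents the information collected up to stage $t-1$, with $\mathcal{F}_{-1}$ trivial. The horizon is $T$, and $\mathcal{T}=\{0,\dots,T-1\}$. Safe set and distance. $A\subseteq\mathbb{R}^n$ is a convex compact Borel set (the desired set for safety), and $\mathrm{dist}(\boldsymbol{x},A):=\inf_{y\in A}\|\boldsymbol{x}-y\|$. Notation: $(a)^+=\max\{a,0\}$. Policies. $\Pi$ is the set of strategies $\pi=(\pi_0,\dots,\pi_{T-1})$ where $\pi_t$ is a stochastic kernel from $H_t$ to $\mathbb{U}$ with $\pi_t(\mathbb{U}\mid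 h_t)=1$ for all $h_t\in H_t$; $H_t$ is the set of histories $h_t=(x_0,w_0,\dots,x_{t-1},w_{t-1},x_t)$. $\mathbb{P}^\pi$ is the probability measure induced by $\pi$, and $\mathrm{CVaR}^\pi_\alpha$ is taken with respect to it. Risk measure. For $\alpha\in(0,1)$, the conditional CVaR is the $\mathcal{F}_{t-1}$-measurable random variable $$\mathrm{CVaR}_\alpha[\mathrm{dist}(x_{t+1},A)\mid\mathcal{F}_{t-1}]:=\min_{Z\in\mathcal{L}_2(\Omega,\mathcal{F}_{t-1},\mathbb{P})} Z+\mathbb{E}\Big[\frac{(\mathrm{dist}(x_{t+1},A)-Z)^+}{1-\alpha}\,\Big|\,\mathcal{F}_{t-1}\Big].$$ Probabilistic safe set (for a set $B\subseteq\mathbb{R}^n$ and a probability level $\beta$): $$S_\beta(B):=\{\boldsymbol{x}\in\mathbb{R}^n\mid\exists\pi\in\Pi\text{ s.t. } x_0=\boldsymbol{x},\ \mathbb{P}^\pi(x_t\in B,\ t=1,\dots,T)\ge\beta\}.$$ Risk-constrained safe set (for $\alpha\in(0,1)$, $\delta\ge0$): $$RS_{\alpha,\delta}(A):=\{\boldsymbol{x}\in\mathbb{R}^n\mid\exists\pi\in\Pi\text{ s.t. } x_0=\boldsymbol{x},\ \mathrm{CVaR}^\pi_\alpha[\mathrm{dist}(x_{t+1},A)\mid\mathcal{F}_{t-1}]\le\delta,\ t\in\mathcal{T}\}.$$ *)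

(* Defs.v *)
From HB Require Import structures.
From mathcomp Require Import all_boot all_order all_algebra.
From mathcomp Require Import all_classical all_reals all_analysis.
From mathcomp Require Import measurable_realfun.

Set Implicit Arguments.
Unset Strict Implicit.
Unset Printing Implicit Defensive.

Import Order.TTheory GRing.Theory Num.Theory.
Import numFieldNormedType.Exports.

Local Open Scope classical_set_scope.
Local Open Scope ring_scope.

(* Borel sigma-algebra of R^n. *)
HB.instance Definition _ (R : realType) (n : nat) :=
  Measurable.copy 'rV[R]_n (g_sigma_algebraType (@open 'rV[R]_n)).

(* A (not necessarily measurable) subset as a measurable space, with the trace
   sigma-algebra.  It is nonempty because measurable types are pointed. *)
Section subspace_type.
Context d (T : measurableType d) (A : set T).

Definition subspace_type (A0 : A !=set0) : Type := A.

Variable A0 : A !=set0.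
Let point_mem : sval (cid A0) \in A := mem_set (svalP (cid A0)).

HB.instance Definition _ := Choice.copy (subspace_type A0) A.
HB.instance Definition _ :=
  isPointed.Build (subspace_type A0) (exist _ (sval (cid A0)) point_mem).
HB.instance Definition _ := Measurable.copy (subspace_type A0)
  (g_sigma_algebra_preimageType (fun x : subspace_type A0 => sval x)).

End subspace_type.

Section distance.
Context (R : realType) (n : nat).
Local Open Scope ereal_scope.

(* The library norm on 'rV[R]_n is the sup norm. *)
Definition euclidean_norm (x : 'rV[R]_n) : R :=
  Num.sqrt (\sum_(i < n) x ord0 i ^+ 2).

(* Extended-real valued so that the distance to the empty set is +oo. *)
Definition dist (x : 'rV[R]_n) (A : set 'rV[R]_n) : \bar R :=
  ereal_inf [set (euclidean_norm (x - y))%:E | y in A].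

Definition enlargement (A : set 'rV[R]_n) (delta : R) : set 'rV[R]_n :=
  [set x | dist x A <= delta%:E].

End distance.

Section conditional_cvar.
Context d (S : measurableType d) (R : realType) (P : probability S R).
Implicit Type G : set (set S).
Local Open Scope ereal_scope.

Definition measurable_wrt G d' (V : measurableType d') (g : S -> V) :=
  forall B, measurable B -> G (g @^-1` B).

(* Y is a version of E[X | G], for X >= 0. *)
Definition is_cond_expectation G (X Y : S -> \bar R) :=
  [/\ measurable_wrt G Y, (forall s, 0 <= Y s) &
      forall B, G B -> \int[P]_(s in B) Y s = \int[P]_(s in B) X s].

Definition L2 G (Z : S -> R) :=
  measurable_wrt G Z /\ 'N[P]_(2%:E)[EFin \o Z] < +oo.

(* C is a version of the objective Z + E[(X - Z)^+ / (1 - alpha) | G]. *)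
Definition is_cvar_objective G (alpha : R) (X : S -> \bar R) (Z : S -> R)
    (C : S -> \bar R) :=
  exists2 Y, is_cond_expectation G
      (fun s => maxe (X s - (Z s)%:E) 0 * ((1 - alpha)^-1)%:E) Y &
    forall s, C s = (Z s)%:E + Y s.

(* C is a version of CVaR_alpha[X | G]: the minimum over Z in L2(G), for the
   almost sure order, of the objectives. *)
Definition is_cond_cvar G (alpha : R) (X C : S -> \bar R) :=
  [/\ measurable_wrt G C,
      (exists Z V, [/\ L2 G Z, is_cvar_objective G alpha X Z V &
                       {ae P, forall s, C s = V s}]) &
      forall Z V, L2 G Z -> is_cvar_objective G alpha X Z V ->
        {ae P, forall s, C s <= V s}].

End conditional_cvar.

Section filtration.
Context d (S : measurableType d).

Definition is_filtration (F : nat -> set (set S)) :=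
  [/\ forall t, sigma_algebra setT (F t),
      forall t, F t `<=` measurable &
      forall s t, (s <= t)%N -> F s `<=` F t].

(* [past F t] is F_(t-1), with F_(-1) trivial. *)
Definition past (F : nat -> set (set S)) (t : nat) : set (set S) :=
  if t is t'.+1 then F t' else [set set0; setT].

End filtration.

(* A sample point is ((x_0, omega), (u_0, ..., u_(k-1))): the initial state, the
   point of the probability space carrying the disturbances, and the controls. *)
Section trajectories.
Context dX dU dW dO (X : measurableType dX) (U : measurableType dU)
  (W : measurableType dW) (O : measurableType dO).
Variables (f : {mfun (X * U * W)%type >-> X}) (w : nat -> {mfun O >-> W}).

Notation sample k := (X * O * k.-tuple U)%type.

(* x_t for t <= k; the branch [None] (t > k) is never used. *)
Fixpoint state (k t : nat) (s : sample k) : X :=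
  if t is t'.+1 then
    if insub t' is Some i then f (state t' s, tnth s.2 i, w t' s.1.2)
    else state t' s
  else s.1.1.

(* (x_0, w_0, ..., x_(t-1), w_(t-1), x_t) *)
Definition history (k t : nat) (s : sample k) : t.-tuple (X * W) * X :=
  ([tuple (state i s, w i s.1.2) | i < t], state t s).

Definition extend (k : nat) (su : sample k * U) : sample k.+1 :=
  (su.1.1, [tuple of rcons su.1.2 su.2]).

Lemma measurable_state k t : measurable_fun setT (@state k t).
Proof.
elim: t => [|t IH] /=; first exact: measurableT_comp.
case: insub => [i|//].
apply: measurableT_comp => //.
apply: measurable_fun_pair => /=.
  apply: measurable_fun_pair => //=.
  by apply: (measurableT_comp (@measurable_tnth _ U k i)).
by apply: measurableT_comp => //; exact: measurableT_comp.
Qed.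

Lemma measurable_history k t : measurable_fun setT (@history k t).
Proof.
apply: measurable_fun_pair; last exact: measurable_state.
apply/measurable_fun_tnthP => i.
rewrite (_ : _ \o _ = (fun s : sample k => (state i s, w i s.1.2))); last first.
  by apply/funext => s /=; rewrite tnth_mktuple.
apply: measurable_fun_pair => /=; first exact: measurable_state.
by apply: measurableT_comp => //; exact: measurableT_comp.
Qed.

Lemma measurable_extend k : measurable_fun setT (@extend k).
Proof.
apply: measurable_fun_pair => /=; first exact: measurableT_comp.
apply/measurable_fun_tnthP => i.
have [ik|ki] := ltnP i k.
  rewrite (_ : _ \o _ = (fun su : sample k * U => tnth su.1.2 (Ordinal ik))).
    apply: (measurableT_comp (@measurable_tnth _ U k _)).
    exact: measurableT_comp.
  apply/funext => su /=; rewrite (tnth_nth point) [RHS](tnth_nth point) /=.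
  by rewrite nth_rcons size_tuple ik.
rewrite (_ : _ \o _ = snd) //.
apply/funext => su /=; rewrite (tnth_nth point) /= nth_rcons size_tuple.
have -> : i = k :> nat by apply/eqP; rewrite eqn_leq ki -ltnS ltn_ord.
by rewrite ltnn eqxx.
Qed.

Context (R : realType).

Section one_step.
Variables (k : nat) (mu : probability (sample k) R)
  (kappa : R.-pker (k.-tuple (X * W) * X)%type ~> U).

(* Law of the sample s extended by u, when s has law mu and u has conditional law
   kappa(h_k(s)) given s. *)
Definition step (D : set (sample k.+1)) : \bar R :=
  (\int[mu]_s kappa (history k s) [set u | D (extend (s, u))])%E.

Let K (s : sample k) : {measure set U -> \bar R} := kappa (history k s).

Let mK B : measurable B -> measurable_fun setT (K ^~ B).
Proof.
move=> mB; apply: (measurableT_comp (measurable_kernel kappa _ mB)).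
exact: measurable_history.
Qed.
HB.instance Definition _ := isKernel.Build _ _ _ _ _ K mK.

Let KT s : K s setT = 1%E. Proof. exact: prob_kernel. Qed.
HB.instance Definition _ := Kernel_isProbability.Build _ _ _ _ _ K KT.

Let sectionE D s :
  [set u | D (extend (s, u))] = xsection (@extend k @^-1` D) s.
Proof. by apply/seteqP; split => u; rewrite xsectionE. Qed.

Let mD D : measurable D -> measurable (@extend k @^-1` D).
Proof. by move=> ?; rewrite -[X in measurable X]setTI; exact: measurable_extend. Qed.

Let step0 : step set0 = 0%E.
Proof. by apply: integral0_eq => s _; exact: measure0. Qed.

Let step_ge0 D : (0 <= step D)%E.
Proof. by apply: integral_ge0. Qed.

Let step_sigma_additive : semi_sigma_additive step.
Proof.
move=> F mF tF mUF; rewrite [X in _ --> X](_ : _ =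
  \int[mu]_s (\sum_(i <oo) K s [set u | F i (extend (s, u))]))%E; last first.
  apply: eq_integral => s _; apply/esym/cvg_lim => //.
  rewrite (_ : [set u | _] = \bigcup_i [set u | F i (extend (s, u))])//.
  apply: measure_semi_sigma_additive.
  - by move=> i; rewrite sectionE; apply: measurable_xsection; exact: mD.
  - by apply/trivIsetP => i j _ _ ij; apply/seteqP; split => // u [Fi Fj];
      move/trivIsetP/(_ i j Logic.I Logic.I ij) : tF => /seteqP[+ _];
      apply; split; [exact: Fi|exact: Fj].
  - apply: bigcup_measurable => i _.
    by rewrite sectionE; apply: measurable_xsection; exact: mD.
apply/cvg_closeP; split.
  by apply: is_cvg_nneseries => i _ _; exact: integral_ge0.
rewrite closeE// integral_nneseries// => i.
under eq_fun do rewrite sectionE.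
by apply: (@measurable_fun_xsection_finite_kernel _ _ _ _ _ K); rewrite inE; exact: mD.
Qed.

HB.instance Definition _ :=
  isMeasure.Build _ _ _ step step0 step_ge0 step_sigma_additive.

Let stepT : step setT = 1%E.
Proof.
rewrite /step (eq_integral (cst 1%E)); last by move=> s _; exact: prob_kernel.
by rewrite integral_cst// mul1e; exact: probability_setT.
Qed.

HB.instance Definition _ := Measure_isProbability.Build _ _ _ step stepT.

End one_step.

Definition start (x : X) (omega : O) : sample 0 := (x, omega, [tuple]).

Lemma measurable_start x : measurable_fun setT (start x).
Proof. by do ! apply: measurable_fun_pair. Qed.
HB.instance Definition _ x :=
  isMeasurableFun.Build _ _ _ _ (start x) (measurable_start x).

Variable T : nat.

Definition policy :=
  forall t : 'I_T, R.-pker (t.-tuple (X * W) * X)%type ~> U.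

Variables (P : probability O R) (pi : policy) (x : X).

(* Joint law of x_0 = x, omega ~ P and the first t controls. *)
Fixpoint law_upto (t : nat) : (t <= T)%N -> probability (sample t) R :=
  if t is t'.+1 then
    fun tT => step (law_upto (ltnW tT)) (pi (Ordinal tT))
  else fun=> distribution P (start x).

Definition law : probability (sample T) R := law_upto (leqnn T).

End trajectories.

Section safe_sets.
Context dU dW dO (R : realType) (n : nat) (U : measurableType dU)
  (W : measurableType dW) (O : measurableType dO).
Notation X := 'rV[R]_n.
Variables (f : {mfun (X * U * W)%type >-> X}) (w : nat -> {mfun O >-> W})
  (P : probability O R) (T : nat).
Local Open Scope ereal_scope.

(* The disturbances are exogenous with joint law given by P and w; the filtration F
   lives on the sample space because randomized policies need their own
   randomness.  In both sets the constraint x_0 = x is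
   built into [law f w P pi x]. *)
Definition probabilistic_safe_set (beta : R) (B : set X) : set X :=
  [set x | exists pi : policy X U W R T,
    beta%:E <= law f w P pi x
      [set s | forall t, (1 <= t <= T)%N -> B (state f w t s)]].

Definition risk_constrained_safe_set
    (F : nat -> set (set (X * O * T.-tuple U)%type)) (alpha delta : R)
    (A : set X) : set X :=
  [set x | exists pi : policy X U W R T, forall t, (t < T)%N ->
    exists2 C, is_cond_cvar (law f w P pi x) (past F t) alpha
                 (fun s => dist (state f w t.+1 s) A) C &
      {ae law f w P pi x, forall s, C s <= delta%:E}].

End safe_sets.

(* Main.v *)
Require Import Defs.
From mathcomp Require Import all_boot all_order all_algebra.
From mathcomp Require Import all_classical all_reals all_analysis.
From mathcomp Require Import measurable_realfun.
From mathcomp Require Import lra.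
Import Order.TTheory GRing.Theory Num.Theory.
Import numFieldNormedType.Exports.
Local Open Scope classical_set_scope.
Local Open Scope ring_scope.
Set Implicit Arguments.
Unset Strict Implicit.
Unset Printing Implicit Defensive.

(** Let X be the distance from x_(t+1) to A, and G the information available one
    step earlier.  If Z attains the conditional CVaR of X and Y is the conditional
    expectation of (X - Z)^+ / (1 - alpha), the constraint says Z + Y <= delta
    almost surely.  Since (X - Z)^+ >= delta - Z on the event X > delta, this
    gives (delta - Z) P(X > delta | G) <= (1 - alpha) (delta - Z), so that
    P(X > delta | G) <= 1 - alpha: each step, given its past, stays in the
    enlargement with probability at least alpha
    ([cvar_cond_tail]).  The event of having been safe so far belongs to that
    past, so the bounds multiply and T steps are safe with probability at least
    alpha ^ T ([iterated_lower_bound]).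

    Dividing by delta - Z is problematic where it is small or zero, and a
    version of P(X > delta | G) would first have to be built.  Both are avoided by
    integrating over events of G only, on which delta - Z is almost constant:
    [cond_expectation_tail_slice] treats one such event.  An event X > delta is
    approximated by the events X >= delta + eps, and delta - Z is cut into slices
    of width eps: where k eps <= delta - Z < (k + 1) eps, one has
    Y <= (k + 1) eps, while X - Z >= (k + 1) eps on X >= delta + eps.  The gain
    eps exactly pays for the width of the slice, so the factor 1 - alpha comes out
    without loss, including on the slice k = 0 that contains Z = delta. *)

(** * Tail bound from a conditional CVaR bound *)

Section conditional_tail.
Context d (S : measurableType d) (R : realType) (P : probability S R).
Variables (G : set (set S)) (sigmaG : sigma_algebra setT G).
Hypothesis subG : G `<=` measurable.

Let GI A B : G A -> G B -> G (A `&` B).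
Proof. by have /(sigma_algebraP (fun X _ => @subsetT _ X))[_ _ _] := sigmaG; apply. Qed.

(** A conditional Markov inequality on a single event B of G, comparing the
    integral of Y over B with c from above and, through the excess over Z, with
    c / (1 - alpha) times the tail event from below. *)
Lemma cond_expectation_tail_slice (X Y : S -> \bar R) (Z : S -> R)
    (alpha theta c : R) (B : set S) :
  alpha < 1 -> 0 < c -> measurable_fun setT X -> measurable_wrt G Z ->
  is_cond_expectation P G
    (fun s => maxe (X s - (Z s)%:E) 0 * ((1 - alpha)^-1)%:E)%E Y ->
  G B -> {ae P, forall s, B s -> (theta%:E <= X s -> (Z s + c)%:E <= X s)%E} ->
  {ae P, forall s, B s -> (Y s <= c%:E)%E} ->
  (P (B `&` [set s | (theta%:E <= X s)%E]) <= (1 - alpha)%:E * P B)%E.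
Proof.
move=> alpha1 c0 mX mZ [mY Y0 intY] GB XZ Yc.
have mB : measurable B by exact: subG.
have mD : measurable [set s | (theta%:E <= X s)%E].
  by rewrite -[X in measurable X]setTI; exact: emeasurable_fun_c_infty.
have a0 : 0 < 1 - alpha by rewrite subr_gt0.
have k0 : 0 < c * (1 - alpha)^-1 by rewrite mulr_gt0// invr_gt0.
have mZ' : measurable_fun setT Z.
  by move=> _ A mA; rewrite setTI; exact/subG/mZ.
have mY' : measurable_fun setT Y.
  by move=> _ A mA; rewrite setTI; exact/subG/mY.
have lowY : ((c / (1 - alpha))%:E * P (B `&` [set s | (theta%:E <= X s)%E])
    <= \int[P]_(s in B) Y s)%E.
  rewrite intY// setIC -integral_indic// -ge0_integralZl_EFin//; last first.
    exact: ltW.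
    exact/measurable_EFinP/measurable_indic.
  apply: ae_ge0_le_integral => //.
  - by move=> s _; rewrite -EFinM lee_fin mulr_ge0// ltW.
  - by apply: emeasurable_funM => //; exact/measurable_EFinP/measurable_indic.
  - by move=> s _; rewrite mule_ge0// ?le_max ?lexx ?orbT// lee_fin invr_ge0 ltW.
  - apply: emeasurable_funM => //; apply: measurable_maxe => //.
    apply: emeasurable_funB; first exact: measurable_funTS.
    by apply/measurable_EFinP; exact: measurable_funTS.
  - apply: filterS XZ => s XZ Bs; rewrite indicE; case: (boolP (s \in _)) => [|_]; last first.
      by rewrite mule0 mule_ge0// ?le_max ?lexx ?orbT// lee_fin invr_ge0 ltW.
    rewrite inE/= mule1 => /(XZ Bs) ZX.
    rewrite EFinM lee_pmul2r// ?lte_fin ?invr_gt0// le_max; apply/orP; left.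
    by rewrite EFinN leeBrDl// -EFinD.
rewrite -(@lee_pmul2l _ (c / (1 - alpha))%:E) ?lte_fin//.
apply: le_trans lowY _; rewrite muleA -EFinM divfK ?gt_eqF//.
rewrite -integral_cst//; apply: ae_ge0_le_integral => //.
- exact: measurable_funTS.
- by move=> s _; rewrite lee_fin ltW.
Qed.

(** This is P(X > delta | G) <= 1 - alpha, stated by integration over the events
    of G so that no version of the conditional probability is needed.  *)
Lemma cvar_cond_tail (X V : S -> \bar R) (Z : S -> R) (alpha delta : R) (B : set S) :
  alpha < 1 -> measurable_fun setT X -> measurable_wrt G Z ->
  is_cvar_objective P G alpha X Z V -> {ae P, forall s, (V s <= delta%:E)%E} ->
  G B ->
  (P (B `&` [set s | (delta%:E < X s)%E]) <= (1 - alpha)%:E * P B)%E.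
Proof.
move=> alpha1 mX mZ [Y condY VE] Vdelta GB.
have Y0 s : (0 <= Y s)%E by case: condY.
have ZY : {ae P, forall s, (Y s <= (delta - Z s)%:E)%E}.
  by apply: filterS Vdelta => s; rewrite VE EFinB leeBrDl.
have mge r : measurable [set s | (r%:E <= X s)%E].
  by rewrite -[X in measurable X]setTI; exact: emeasurable_fun_c_infty.
have tail eps : 0 < eps ->
    (P (B `&` [set s | ((delta + eps)%:E <= X s)%E]) <= (1 - alpha)%:E * P B)%E.
  move=> eps0.
  (* Num.truncn is 0 on negative numbers, so the slices cover all of B; the part
     where Z > delta lies in slice 0 and is negligible by [ZY] and [Y0]. *)
  pose level (r : R) : nat := Num.truncn ((delta - r) / eps).
  pose slice k := B `&` (level \o Z) @^-1` [set k].
  have Gslice k : G (slice k).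
    apply: GI => //; rewrite comp_preimage; apply: mZ.
    rewrite (_ : _ @^-1` _ = (fun r => (level r)%:R : R) @^-1` [set k%:R]); last first.
      apply/seteqP; split=> r /=; first by move=> ->.
      by move/eqP; rewrite eqr_nat => /eqP.
    rewrite -[X in measurable X]setTI.
    apply: nonincreasing_measurable => // x y xy /=.
    by rewrite ler_nat; apply: le_truncn; rewrite ler_pM2r ?invr_gt0// lerB.
  have mslice k : measurable (slice k) by exact: subG.
  have Bslice : B = \bigcup_k slice k.
    by rewrite -setI_bigcupr -preimage_bigcup bigcup_imset1 image_id preimage_setT setIT.
  have tslice : trivIset setT slice by exact: trivIset_preimage1_in.
  rewrite [in leLHS]Bslice setI_bigcupl [in leRHS]Bslice.
  rewrite !measure_semi_bigcup//; last 4 first.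
    by apply: bigcup_measurable => k _.
    by move=> k; apply: measurableI.
    exact: trivIset_setIr.
    by apply: bigcup_measurable => k _; exact: measurableI.
  rewrite -nneseriesZl//; apply: lee_nneseries => // k _.
  have sliceP s : slice k s -> Z s <= delta ->
      k%:R * eps <= delta - Z s < k.+1%:R * eps.
    move=> [_ /= <-] Zd.
    by rewrite -ler_pdivlMr// -ltr_pdivrMr// truncn_itv// divr_ge0// ?subr_ge0// ltW.
  apply: (@cond_expectation_tail_slice X Y Z alpha _ (k.+1%:R * eps)) => //.
  - by rewrite mulr_gt0.
  - apply: filterS ZY => s ZY /sliceP; have := le_trans (Y0 s) ZY.
    rewrite lee_fin subr_ge0 => Zd /(_ Zd)/andP[kZ _]; apply: le_trans.
    rewrite lee_fin; rewrite mulrS; lra.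
  - apply: filterS ZY => s ZY /sliceP; have := le_trans (Y0 s) ZY.
    rewrite lee_fin subr_ge0 => Zd /(_ Zd)/andP[_ /ltW Zk].
    by apply: le_trans ZY _; rewrite lee_fin.
pose D j := B `&` [set s | ((delta + j.+1%:R^-1)%:E <= X s)%E].
have mD j : measurable (D j) by apply: measurableI => //; exact: subG.
have DE : B `&` [set s | (delta%:E < X s)%E] = \bigcup_j D j.
  rewrite -setI_bigcupr; congr (_ `&` _); apply/seteqP; split=> s /=.
    move=> dX; case Xs : (X s) dX => [r| |].
    - by rewrite lte_fin => /ltr_add_invr[j /ltW dj]; exists j; rewrite //= Xs lee_fin.
    - by exists 0%N; rewrite //= Xs leey.
    - by [].
  by move=> [j _ /=]; apply: lt_le_trans; rewrite lte_fin ltrDl invr_gt0.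
have mDU : measurable (\bigcup_j D j) by apply: bigcup_measurable.
have ndD : {homo D : i j / (i <= j)%N >-> (i <= j)%O}.
  move=> i j ij; apply/subsetPset; apply: setIS => s /=; apply: le_trans.
  by rewrite lee_fin lerD2l lef_pV2 ?posrE// ler_nat ltnS.
have cvgD := nondecreasing_cvg_mu (mu := P) mD mDU ndD.
rewrite DE -(cvg_lim _ cvgD)//; apply: lime_le; first by apply/cvg_ex; eexists; exact: cvgD.
by apply: nearW => j; apply: tail; rewrite invr_gt0.
Qed.

End conditional_tail.

(** * Measurability of the distance *)

Lemma continuous_euclidean_norm (R : realType) (n : nat) (y : 'rV[R]_n) :
  continuous (fun x : 'rV[R]_n => euclidean_norm (x - y)).
Proof.
suff sq : continuous (fun x : 'rV[R]_n => \sum_(i < n) (x - y) ord0 i ^+ 2).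
  by move=> x; apply: (continuous_comp (sq x)); exact: sqrt_continuous.
rewrite (_ : (fun x => _) =
    \sum_(i < n) (fun x : 'rV[R]_n => (x - y) ord0 i ^+ 2)); last first.
  by apply/funext => x; rewrite fct_sumE.
elim/big_ind : _ => [|f g cf cg|i _]; first exact: cst_continuous.
  by move=> x; apply: continuousD; [exact: cf|exact: cg].
move=> x; apply: (@continuous_comp _ _ _ (fun z : 'rV[R]_n => (z - y) ord0 i)
  (fun r : R => r ^+ 2)); last exact: exprn_continuous.
apply: (@continuous_comp _ _ _ (fun z : 'rV[R]_n => z - y)
  (fun z : 'rV[R]_n => z ord0 i)); last exact: coord_continuous.
by apply: continuousB; [exact: cvg_id|exact: cst_continuous].
Qed.

(** An infimum is below c as soon as one of its terms is, so this set is a union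
    of open Euclidean balls; this covers an empty A as well. *)
Lemma open_dist_lt (R : realType) (n : nat) (A : set 'rV[R]_n) (c : R) :
  open [set x | (dist x A < c%:E)%E].
Proof.
rewrite (_ : [set _ | _] =
    \bigcup_(y in A) [set x | euclidean_norm (x - y) < c]); last first.
  apply/seteqP; split=> x /=.
    by move=> /ereal_inf_ltP[_ [y Ay <-]]; rewrite lte_fin => xyc; exists y.
  move=> [y Ay /= xyc]; apply/ereal_inf_ltP.
  by exists (euclidean_norm (x - y))%:E; [exists y|rewrite lte_fin].
apply: bigcup_open => y _.
apply: (@open_comp _ _ (fun x : 'rV[R]_n => euclidean_norm (x - y)) [set r | r < c]).
  by move=> x _; exact: continuous_euclidean_norm.
exact: open_lt.
Qed.

Lemma measurable_dist (R : realType) (n : nat) (A : set 'rV[R]_n) :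
  measurable_fun setT (fun x : 'rV[R]_n => dist x A).
Proof.
apply: (measurability _ (ErealGenInftyO.measurableE R)) => _ /= -[_ [c ->] <-].
rewrite setTI preimage_itvNyo; apply: sub_sigma_algebra; exact: open_dist_lt.
Qed.

(** * Multiplying the one-step bounds *)

Lemma sigma_algebra_past d (S : measurableType d) (F : nat -> set (set S)) t :
  is_filtration F -> sigma_algebra setT (past F t).
Proof.
move=> [sigmaF _ _]; case: t => [|t] /=; last exact: sigmaF.
split; first by left.
- by move=> _ [->|->]; rewrite ?setD0 ?setDv; [right|left].
- move=> B B01; have [[k Bk]|B0] := pselect (exists k, B k = setT).
    by right; apply/seteqP; split=> // s _; exists k => //; rewrite Bk.
  left; apply/seteqP; split=> // s [k _].
  by case: (B01 k) => [->//|BkT]; case: B0; exists k.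
Qed.

Lemma past_measurable d (S : measurableType d) (F : nat -> set (set S)) t :
  is_filtration F -> past F t `<=` measurable.
Proof.
move=> [_ subF _]; case: t => [|t] /=; last exact: subF.
by move=> _ [->|->].
Qed.

Lemma sub_past d (S : measurableType d) (F : nat -> set (set S)) t :
  is_filtration F -> past F t `<=` F t.
Proof.
move=> [sigmaF _ mono]; case: t => [|t] /=; last exact: mono.
have [F0 FC _] := sigmaF 0%N.
by move=> _ [->|->] //; rewrite -(setD0 setT); exact: FC.
Qed.

(** The events up to step t - 1 all belong to F_(t-1), hence so does their
    intersection, which the one-step bound then shrinks by a factor at least
    alpha.  Membership in the past is therefore part of the induction; it starts
    at setT, which the trivial sigma-algebra contains. *)
Lemma iterated_lower_bound d (S : measurableType d) (R : realType)
    (P : probability S R) (F : nat -> set (set S)) (D : nat -> set S)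
    (alpha : R) (T : nat) :
  is_filtration F -> 0 <= alpha ->
  (forall t, (t < T)%N -> F t (D t)) ->
  (forall t B, (t < T)%N -> past F t B ->
    (P (B `&` ~` D t) <= (1 - alpha)%:E * P B)%E) ->
  ((alpha ^+ T)%:E <= P [set s | forall t, (t < T)%N -> D t s])%E.
Proof.
move=> filtF alpha0 FD tail.
pose E t := [set s | forall i, (i < t)%N -> D i s].
have ES t : E t.+1 = E t `&` D t.
  apply/seteqP; split=> s /=.
    by move=> Ds; split; [move=> i it; apply: Ds; exact: ltnW|exact: Ds].
  move=> [Ds Dt] i; rewrite ltnS leq_eqVlt => /predU1P[->//|]; exact: Ds.
have E0 : E 0%N = setT by apply/seteqP; split.
suff H t : (t <= T)%N -> past F t (E t) /\ ((alpha ^+ t)%:E <= P (E t))%E.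
  by have [] := H T (leqnn T).
elim: t => [_|t IH tT]; first by rewrite E0 expr0 probability_setT; split=> //; right.
have [pE aE] := IH (ltnW tT).
have FE : F t (E t) by exact: (sub_past filtF).
have [sigmaF subF _] := filtF.
have mE := subF _ _ FE; have mD := subF _ _ (FD _ tT).
have FI : F t (E t `&` D t).
  have /(sigma_algebraP (fun X _ => @subsetT _ X))[_ _ _] := sigmaF t.
  by apply => //; exact: FD.
rewrite ES; split => //.
have mI := measurableI _ _ mE mD; have mS := measurableD mE mD.
have [q qE] : exists q : R, P (E t `&` D t) = q%:E.
  by exists (fine (P (E t `&` D t))); rewrite fineK// fin_num_measure.
have [r rE] : exists r : R, P (E t `\` D t) = r%:E.
  by exists (fine (P (E t `\` D t))); rewrite fineK// fin_num_measure.
have PE : P (E t) = (r + q)%:E by rewrite EFinD -rE -qE; exact: measureDI.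
have := tail t (E t) tT pE; move: aE; rewrite -setDE PE qE rE.
rewrite -EFinM !lee_fin exprS => aE rle.
have := ler_wpM2l alpha0 aE; lra.
Qed.

Theorem proposition3 (R : realType) (n m l T : nat)
    (U : set 'rV[R]_m) (U0 : U !=set0) (convU : @convex_set R 'rV[R]_m U)
    (W : set 'rV[R]_l) (W0 : W !=set0)
    (dO : measure_display) (O : measurableType dO) (P : probability O R)
    (f : {mfun ('rV[R]_n * subspace_type U0 * subspace_type W0)%type >->
               'rV[R]_n})
    (w : nat -> {mfun O >-> subspace_type W0})
    (F : nat -> set (set ('rV[R]_n * O * T.-tuple (subspace_type U0))%type))
    (filtF : is_filtration F)
    (adaptw : forall t, measurable_wrt (F t) (fun s => w t s.1.2))
    (adaptx : forall t, (t < T)%N -> measurable_wrt (F t) (state f w t.+1))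
    (A : set 'rV[R]_n) (convA : @convex_set R 'rV[R]_n A) (compA : compact A)
    (measA : measurable A)
    (alpha delta : R) (alpha01 : 0 < alpha < 1) (delta_gt0 : 0 < delta) :
  risk_constrained_safe_set f w P F alpha delta A `<=`
  probabilistic_safe_set f w P T (alpha ^+ T) (enlargement A delta).
Proof.
have /andP[alpha0 alpha1] := alpha01.
move=> x [pi safe]; exists pi.
set law_pi := law f w P pi x in safe *.
pose D t := [set s : 'rV[R]_n * O * T.-tuple (subspace_type U0) |
  enlargement A delta (state f w t.+1 s)].
rewrite (_ : [set s | _] = [set s | forall t, (t < T)%N -> D t s]); last first.
  apply/seteqP; split=> s /= Ds t; first by move=> tT; apply: Ds.
  by case: t => // t /andP[_ tT]; exact: Ds.
have mA : measurable (enlargement A delta).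
  rewrite -[X in measurable X]setTI.
  exact: emeasurable_fun_infty_c (@measurable_dist R n A) _.
apply: (@iterated_lower_bound _ _ _ law_pi F) => //; first exact: ltW.
  by move=> t tT; exact: adaptx.
move=> t B tT pB; have [C [_ [Z [V [[mZ _] objV CV]]] _] Cdelta] := safe t tT.
have -> : ~` D t = [set s | (delta%:E < dist (state f w t.+1 s) A)%E].
  by apply/seteqP; split=> s; rewrite /D /enlargement /= ltNge => /negP.
apply: cvar_cond_tail mZ objV _ pB => //.
- exact: sigma_algebra_past.
- exact: past_measurable.
- by apply: (measurableT_comp (@measurable_dist R n A)); exact: measurable_state.
- by apply: filterS2 CV Cdelta => s ->.
Qed.
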